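(* For every $b\in(0,\infty)$, $$L(b)<\mathcal{M}(\Gamma_b)<U(b),$$ where $$L(b):=\frac{2}{\pi}\left(1-\left(1+\sqrt{4b/\pi}\right)^{-4}\right)^{1/4}\log\left(2\left(1+\sqrt{4b/\pi}\right)\right)>\frac{2}{\pi}\left(1-\left(1+\sqrt{4b/\pi}\right)^{-1}\right)\log\left(2\left(1+\sqrt{4b/\pi}\right)\right)$$ and $$U(b):=\frac{1}{\pi}\log\left(2\left(1+\sqrt{\pi b}\right)^2\left(1+\sqrt{1-\left(1+\sqrt{\pi b}\right)^{-4}}\right)\right)<\frac{2}{\pi}\log\left(2\left(1+\sqrt{\pi b}\right)\right).$$
   Context: For $b>0$ let $R=[0,1]\times[0,b]$ and let $\Gamma_b$ be the family of curves joining the two opposite sides of length $b$ of the rectangle $R$ in the exterior of $R$; $\mathcal{M}(\Gamma_b)$ denotes the (conformal) modulus of this curve family. For $0<r<1$ let $\mathcal{K}(r)=\int_0^{\pi/2}\frac{dt}{\sqrt{1-r^2\sin^2t}}$ and $\mathcal{E}(r)=\int_0^{\pi/2}\sqrt{1-r^2\sin^2t}\,dt$ be the complete elliptic integrals, $r'=\sqrt{1-r^2}$, $\mathcal{K}'(r)=\mathcal{K}(r')$, $\mathcal{E}'(r)=\mathcal{E}(r')$ (not derivatives). Let $\psi:(0,1)\to(0,\infty)$, $\psi(r)=\frac{2(\mathcal{E}(r)-(1-r)\mathcal{K}(r))}{\mathcal{E}'(r)-r\mathcal{K}'(r)}$, which is an increasing homeomorphism onto $(0,\infty)$, and $\mu(r)=\frac{\pi}{2}\frac{\mathcal{K}'(r)}{\mathcal{K}(r)}$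 for $r\in(0,1)$. By the known formula of Duren and Pfaltzgraff, which is the expression for the modulus used throughout, $$\mathcal{M}(\Gamma_b)=\frac{1}{\pi}\mu(\psi^{-1}(1/b)).$$ *)

(* Defs.v *)
From Stdlib Require Import Reals ClassicalEpsilon.
From Coquelicot Require Import Coquelicot.
Open Scope R_scope.

(* Complete elliptic integrals as functions of the modulus r, for 0 < r < 1. *)
Definition ellK (r : R) : R :=
  RInt (fun t => / sqrt (1 - r ^ 2 * sin t ^ 2)) 0 (PI / 2).

Definition ellE (r : R) : R :=
  RInt (fun t => sqrt (1 - r ^ 2 * sin t ^ 2)) 0 (PI / 2).

(* The primes denote the complementary modulus, not derivatives. *)
Definition ellK' (r : R) : R := ellK (sqrt (1 - r ^ 2)).
Definition ellE' (r : R) : R := ellE (sqrt (1 - r ^ 2)).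

Definition psi (r : R) : R :=
  2 * (ellE r - (1 - r) * ellK r) / (ellE' r - r * ellK' r).

(* psi is a bijection from (0,1) onto (0,+oo), so for y > 0 this is the unique
   r in (0,1) with psi r = y; the value is unspecified for other y. *)
Definition psi_inv (y : R) : R :=
  epsilon (inhabits 0) (fun r => 0 < r < 1 /\ psi r = y).

Definition mu (r : R) : R := PI / 2 * (ellK' r / ellK r).

(* Modulus of the family of curves joining, in the exterior of the rectangle
   [0,1] x [0,b], its two opposite sides of length b, given by the
   Duren-Pfaltzgraff formula. *)
Definition modulus_Gamma (b : R) : R := 1 / PI * mu (psi_inv (1 / b)).

(* Rpower is the real power; its base here is positive when b > 0. *)
Definition lower_bound (b : R) : R :=
  2 / PI * Rpower (1 - / (1 + sqrt (4 * b / PI)) ^ 4) (1 / 4)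
  * ln (2 * (1 + sqrt (4 * b / PI))).

Definition upper_bound (b : R) : R :=
  1 / PI * ln (2 * (1 + sqrt (PI * b)) ^ 2
               * (1 + sqrt (1 - / (1 + sqrt (PI * b)) ^ 4))).

(* Main.v *)
Require Import Defs.
From Stdlib Require Import Reals Lra ClassicalEpsilon.
From Coquelicot Require Import Coquelicot.
Open Scope R_scope.

(** With [r = psi_inv (1 / b)] and [q = sqrt r], the theorem combines
      [4 / PI * (q / (1 - q))^2 < psi r < PI * (q / (1 - q))^2], that is,
      [1 + sqrt (4 b / PI) < 1 / q < 1 + sqrt (PI b)],
    with the bounds, both decreasing in [r],
      [sqrt r' * ln (4 / r) < mu r < ln (2 (1 + r') / r)].

    The numerator and denominator of [psi] and the integrals [K], [K'] are
    estimated by comparing integrands with derivatives of explicit functions;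
    the denominator, whose integrand changes sign, is first turned into the
    integral of a multiple of a square by adding an exact derivative.
    The lower bound of [mu] follows from [K r <= PI / (2 sqrt r')] and
    [K' r > ln (4 / r)].  For the upper bound, Gauss' transformation gives
    [mu r = mu r1 / 2] with [r1 = (1 - r') / (1 + r')], whereas
    [ln (4 / r1) / 2 = ln (2 (1 + r') / r) < ln (4 / r)]; iterating a crude
    bound [mu r <= ln (4 / r) + C] halves [C] at each step. *)

(** * Comparison of an integral with the increment of a primitive *)

(** Mean value theorem for [RInt g a x - F x]. Since [c] is interior, a pointwise comparison of [g]
    with [f] on the open interval carries over to the integral, strict inequalities included. *)
Lemma RInt_minus_primitive (F f g : R -> R) (a b : R) :
  a < b -> (forall x, continuous g x) ->
  (forall x, a <= x <= b -> is_derive F x (f x)) ->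
  exists c, a < c < b /\
    RInt g a b = F b - F a + (g c - f c) * (b - a).
Proof.
intros Hab Hg HF.
destruct (MVT_cor2 (fun x => RInt g a x - F x) (fun x => g x - f x) a b Hab)
  as [c [Hc Hc']].
- intros c Hc; apply is_derive_Reals.
  apply (is_derive_minus (RInt g a) F); [| now apply HF].
  apply (is_derive_RInt g _ a); [| apply Hg].
  apply filter_forall; intros y.
  apply (RInt_correct g), ex_RInt_continuous; intros; apply Hg.
- exists c; split; [easy |].
  rewrite RInt_point in Hc; unfold zero in Hc; simpl in Hc; lra.
Qed.

Lemma RInt_le_primitive (F f g : R -> R) (a b : R) :
  a < b -> (forall x, continuous g x) ->
  (forall x, a <= x <= b -> is_derive F x (f x)) ->
  (forall x, a < x < b -> g x <= f x) ->
  RInt g a b <= F b - F a.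
Proof.
intros Hab Hg HF Hle.
destruct (RInt_minus_primitive F f g a b Hab Hg HF) as [c [Hc E]].
specialize (Hle c Hc); nra.
Qed.

Lemma RInt_lt_primitive (F f g : R -> R) (a b : R) :
  a < b -> (forall x, continuous g x) ->
  (forall x, a <= x <= b -> is_derive F x (f x)) ->
  (forall x, a < x < b -> g x < f x) ->
  RInt g a b < F b - F a.
Proof.
intros Hab Hg HF Hlt.
destruct (RInt_minus_primitive F f g a b Hab Hg HF) as [c [Hc E]].
specialize (Hlt c Hc); nra.
Qed.

Lemma RInt_ge_primitive (F f g : R -> R) (a b : R) :
  a < b -> (forall x, continuous g x) ->
  (forall x, a <= x <= b -> is_derive F x (f x)) ->
  (forall x, a < x < b -> f x <= g x) ->
  F b - F a <= RInt g a b.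
Proof.
intros Hab Hg HF Hle.
destruct (RInt_minus_primitive F f g a b Hab Hg HF) as [c [Hc E]].
specialize (Hle c Hc); nra.
Qed.

Lemma RInt_gt_primitive (F f g : R -> R) (a b : R) :
  a < b -> (forall x, continuous g x) ->
  (forall x, a <= x <= b -> is_derive F x (f x)) ->
  (forall x, a < x < b -> f x < g x) ->
  F b - F a < RInt g a b.
Proof.
intros Hab Hg HF Hlt.
destruct (RInt_minus_primitive F f g a b Hab Hg HF) as [c [Hc E]].
specialize (Hlt c Hc); nra.
Qed.

Lemma ex_derive_continuous_R (f : R -> R) (x : R) :
  ex_derive f x -> continuous f x.
Proof. apply (ex_derive_continuous f). Qed.

Lemma ex_RInt_continuous_R (f : R -> R) (a b : R) :
  (forall x, continuous f x) -> ex_RInt f a b.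
Proof. intros H; apply (ex_RInt_continuous f); intros; apply H. Qed.

(** * The radicand in terms of the complementary modulus *)

Lemma cos2_sin2 (t : R) : cos t ^ 2 = 1 - sin t ^ 2.
Proof. generalize (sin2_cos2 t); unfold Rsqr; nra. Qed.

(** This is [1 - k ^ 2 * sin t ^ 2] with [k ^ 2 = 1 - j ^ 2]. With the complementary modulus as
    parameter, [K] and [K'] become values of one function, at [sqrt (1 - r ^ 2)] and at [r]. *)
Definition ellW (j t : R) : R := cos t ^ 2 + j ^ 2 * sin t ^ 2.

Lemma ellW_pos (j t : R) : 0 < j -> 0 < ellW j t.
Proof.
intros Hj; unfold ellW.
generalize (cos2_sin2 t) (pow2_ge_0 (sin t)) (pow2_ge_0 (cos t)); intros H Hs Hc.
destruct (Req_dec (sin t) 0) as [E | E]; [nra |].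
assert (0 < sin t ^ 2) by (now apply pow2_gt_0).
assert (0 < j ^ 2) by nra. nra.
Qed.

Lemma continuous_inv_sqrt_ellW (j t : R) : 0 < j ->
  continuous (fun t => / sqrt (ellW j t)) t.
Proof.
intros Hj; generalize (ellW_pos j t Hj); unfold ellW; intros H.
apply ex_derive_continuous_R.
auto_derive.
generalize (sqrt_lt_R0 _ H); intros. repeat split; auto; apply Rgt_not_eq; assumption.
Qed.

(* [atan (l * tan t) / l] on [0, PI / 2), in a form that is smooth at [PI / 2]. *)
Definition angle (l t : R) : R :=
  (t - atan ((1 - l) * (sin t * cos t) / (cos t ^ 2 + l * sin t ^ 2))) / l.

(** By the subtraction formula of the tangent, the [atan] term in [angle] is [t - atan (l * tan t)]
    before [PI / 2], and [atan (l * tan t)] has derivative [l / ellW l t]. *)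
Lemma is_derive_angle (l t : R) : 0 < l -> is_derive (angle l) t (/ ellW l t).
Proof.
intros Hl; unfold angle.
assert (H1 : 0 < cos t ^ 2 + l * sin t ^ 2).
{ generalize (ellW_pos (sqrt l) t (sqrt_lt_R0 _ Hl)); unfold ellW.
  rewrite pow2_sqrt; lra. }
generalize (ellW_pos l t Hl); unfold ellW; intros H2.
auto_derive.
- repeat split; lra.
- pose proof (cos2_sin2 t) as E.
  set (s := sin t) in *; set (c := cos t) in *.
  field [E]; repeat split; nra.
Qed.

Lemma angle_0 (l : R) : 0 < l -> angle l 0 = 0.
Proof.
intros Hl; unfold angle, Rdiv.
now rewrite sin_0, Rmult_0_l, Rmult_0_r, Rmult_0_l, atan_0, Rminus_0_r, Rmult_0_l.
Qed.

Lemma angle_PI2 (l : R) : 0 < l -> angle l (PI / 2) = PI / (2 * l).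
Proof.
intros Hl; unfold angle.
rewrite cos_PI2, !Rmult_0_r; unfold Rdiv at 3.
rewrite Rmult_0_l, atan_0; field; lra.
Qed.

Lemma sqrt_lt_of_sq (x y : R) : 0 <= x -> 0 < y -> x < y * y -> sqrt x < y.
Proof.
intros Hx Hy H; rewrite <- (sqrt_square y) by lra; apply sqrt_lt_1; nra.
Qed.

(** In terms of the arithmetic-geometric mean [M], this is [PI / (2 * M (1, j))]; the invariance of
    [M] under one averaging step is Gauss' transformation below. *)
Definition ellJ (j : R) : R := RInt (fun t => / sqrt (ellW j t)) 0 (PI / 2).

Lemma ellW_complement (r t : R) : 0 < r < 1 ->
  1 - r ^ 2 * sin t ^ 2 = ellW (sqrt (1 - r ^ 2)) t.
Proof.
intros Hr; unfold ellW; rewrite pow2_sqrt by nra; rewrite cos2_sin2; ring.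
Qed.

Lemma ellW_complement' (r t : R) : 0 < r < 1 ->
  1 - (sqrt (1 - r ^ 2)) ^ 2 * sin t ^ 2 = ellW r t.
Proof.
intros Hr; unfold ellW; rewrite pow2_sqrt by nra; rewrite cos2_sin2; ring.
Qed.

Lemma ellK_ellJ (r : R) : 0 < r < 1 -> ellK r = ellJ (sqrt (1 - r ^ 2)).
Proof.
intros Hr; apply RInt_ext; intros t _; now rewrite <- ellW_complement.
Qed.

Lemma ellK'_ellJ (r : R) : 0 < r < 1 -> ellK' r = ellJ r.
Proof.
intros Hr; apply RInt_ext; intros t _; now rewrite ellW_complement'.
Qed.

Lemma sincos_pos (t : R) : 0 < t < PI / 2 -> 0 < sin t < 1 /\ 0 < cos t < 1.
Proof.
intros Ht.
assert (0 < sin t) by (apply sin_gt_0; lra).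
assert (0 < cos t) by (apply cos_gt_0; lra).
generalize (cos2_sin2 t); intros; split; nra.
Qed.

(** The weights are chosen so that [1 / q] and [q / ellW j] both have integral [PI / (2 * q)], which
    is then also that of their arithmetic mean. *)
Lemma ellJ_le (j : R) : 0 < j < 1 -> ellJ j <= PI / (2 * sqrt j).
Proof.
intros Hj.
set (q := sqrt j).
assert (Hq : 0 < q) by (apply sqrt_lt_R0; lra).
assert (Eq : q * q = j) by (apply sqrt_sqrt; lra).
assert (Hq1 : q < 1) by nra.
assert (HR := PI_RGT_0).
replace (PI / (2 * q)) with
  (/ 2 * (/ q * (PI / 2) + q * angle j (PI / 2))
   - / 2 * (/ q * 0 + q * angle j 0))
  by (rewrite angle_0, angle_PI2, <- Eq by lra; field; lra).
apply (RInt_le_primitive (fun t => / 2 * (/ q * t + q * angle j t))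
  (fun t => / 2 * (/ q + q * / ellW j t))).
- lra.
- intros; apply continuous_inv_sqrt_ellW; lra.
- intros t _.
  assert (HA : is_derive (fun t => angle j t) t (/ ellW j t))
    by (apply is_derive_angle; lra).
  auto_derive; [now exists (/ ellW j t) |].
  replace (Derive (fun x : R => angle j x) t) with (/ ellW j t)
    by (symmetry; now apply is_derive_unique).
  ring.
- intros t Ht; destruct (sincos_pos t Ht) as [Hs Hc].
  pose proof (ellW_pos j t ltac:(lra)) as Hw.
  pose proof (sqrt_lt_R0 _ Hw) as Hv.
  pose proof (sqrt_sqrt (ellW j t) ltac:(lra)) as Ev.
  set (v := sqrt (ellW j t)) in *; rewrite <- Ev.
  (* AM-GM: 1 / v is the geometric mean of 1 / q and q / v^2. *)
  assert (0 <= (v - q) ^ 2 / (2 * q * (v * v)))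
    by (apply Rdiv_le_0_compat; [apply pow2_ge_0 | nra]).
  enough (/ 2 * (/ q + q * / (v * v)) - / v = (v - q) ^ 2 / (2 * q * (v * v)))
    by lra.
  field; lra.
Qed.

(** * Integral forms for [psi], and bounds of its numerator *)

Lemma sqrt_ellW (j t : R) : 0 < j ->
  0 < sqrt (ellW j t) /\ sqrt (ellW j t) ^ 2 = ellW j t.
Proof.
intros Hj; pose proof (ellW_pos j t Hj); split.
- now apply sqrt_lt_R0.
- apply pow2_sqrt; lra.
Qed.

Lemma continuous_sqrt_ellW (j t : R) : 0 < j ->
  continuous (fun t => sqrt (ellW j t)) t.
Proof.
intros Hj; generalize (ellW_pos j t Hj); unfold ellW; intros H.
apply ex_derive_continuous_R; auto_derive; auto.
Qed.

Lemma continuous_ellW_sub (j a t : R) : 0 < j ->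
  continuous (fun t => (ellW j t - a) / sqrt (ellW j t)) t.
Proof.
intros Hj; pose proof (ellW_pos j t Hj) as H; pose proof (sqrt_lt_R0 _ H) as H'.
revert H H'; unfold ellW; intros H H'.
apply ex_derive_continuous_R; auto_derive.
repeat split; auto; apply Rgt_not_eq; assumption.
Qed.

(** Merges a combination [E - a K] into a single integrand, ready for pointwise comparison. *)
Lemma RInt_ellW_sub (j a : R) : 0 < j ->
  RInt (fun t => sqrt (ellW j t)) 0 (PI / 2) - a * ellJ j =
  RInt (fun t => (ellW j t - a) / sqrt (ellW j t)) 0 (PI / 2).
Proof.
intros Hj; unfold ellJ.
change (a * RInt (fun t => / sqrt (ellW j t)) 0 (PI / 2))
  with (scal a (RInt (fun t => / sqrt (ellW j t)) 0 (PI / 2))).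
rewrite <- (RInt_scal (fun t => / sqrt (ellW j t)))
  by (apply ex_RInt_continuous_R; intros; now apply continuous_inv_sqrt_ellW).
match goal with |- ?x - ?y = _ => change (x - y) with (minus x y) end.
rewrite <- (RInt_minus (fun t => sqrt (ellW j t))).
- apply RInt_ext; intros t _.
  destruct (sqrt_ellW j t Hj) as [Hv Ev].
  unfold minus, plus, opp, scal; simpl; unfold mult; simpl.
  set (v := sqrt (ellW j t)) in *; rewrite <- Ev; field; lra.
- apply ex_RInt_continuous_R; intros; now apply continuous_sqrt_ellW.
- apply (ex_RInt_scal (V := R_NormedModule)).
  apply ex_RInt_continuous_R; intros; now apply continuous_inv_sqrt_ellW.
Qed.

Lemma psi_num_integral (r : R) : 0 < r < 1 ->
  ellE r - (1 - r) * ellK r =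
  RInt (fun t => (ellW (sqrt (1 - r ^ 2)) t - (1 - r)) / sqrt (ellW (sqrt (1 - r ^ 2)) t))
    0 (PI / 2).
Proof.
intros Hr; rewrite ellK_ellJ by lra.
rewrite <- RInt_ellW_sub by (apply sqrt_lt_R0; nra).
f_equal; apply RInt_ext; intros t _; now rewrite <- ellW_complement.
Qed.

Lemma psi_den_integral (r : R) : 0 < r < 1 ->
  ellE' r - r * ellK' r =
  RInt (fun t => (ellW r t - r) / sqrt (ellW r t)) 0 (PI / 2).
Proof.
intros Hr; rewrite ellK'_ellJ by lra.
rewrite <- RInt_ellW_sub by lra.
f_equal; apply RInt_ext; intros t _; now rewrite <- ellW_complement'.
Qed.

(** With [s = sin t], the integrand is [r * (1 - r * s ^ 2) / sqrt (1 - r ^ 2 * s ^ 2)], which lies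
    strictly between [r * cos t] and [r]. Both comparisons are checked after squaring. *)
Lemma psi_num_bounds (r : R) : 0 < r < 1 ->
  r < ellE r - (1 - r) * ellK r < r * (PI / 2).
Proof.
intros Hr; rewrite psi_num_integral by lra.
assert (HR := PI_RGT_0).
assert (Hj : 0 < sqrt (1 - r ^ 2)) by (apply sqrt_lt_R0; nra).
split.
- replace r with (r * sin (PI / 2) - r * sin 0) at 1
    by (rewrite sin_PI2, sin_0; ring).
  apply (RInt_gt_primitive (fun t => r * sin t) (fun t => r * cos t)); try lra.
  + intros; now apply continuous_ellW_sub.
  + intros; auto_derive; auto; ring.
  + intros t Ht; destruct (sincos_pos t Ht) as [Hs Hc].
    destruct (sqrt_ellW _ t Hj) as [Hv Ev]; set (v := sqrt (ellW _ t)) in *.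
    pose proof (cos2_sin2 t) as E.
    apply (Rlt_div_r _ _ v); [easy |].
    rewrite <- ellW_complement in Ev |- * by lra.
    set (s := sin t) in *; set (c := cos t) in *.
    enough (r * (c * v) < r * (1 - r * s ^ 2)) by lra.
    apply Rmult_lt_compat_l; [easy |].
    assert ((c * v) ^ 2 < (1 - r * s ^ 2) ^ 2).
    { rewrite Rpow_mult_distr, Ev, E.
      enough (0 < s ^ 2 * (1 - r) ^ 2) by nra.
      apply Rmult_lt_0_compat; apply pow_lt; lra. }
    assert (0 < 1 - r * s ^ 2) by nra.
    assert (0 < c * v) by nra. nra.
- replace (r * (PI / 2)) with (r * (PI / 2) - r * 0) by ring.
  apply (RInt_lt_primitive (fun t => r * t) (fun t => r)); try lra.
  + intros; now apply continuous_ellW_sub.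
  + intros; auto_derive; auto; ring.
  + intros t Ht; destruct (sincos_pos t Ht) as [Hs Hc].
    destruct (sqrt_ellW _ t Hj) as [Hv Ev]; set (v := sqrt (ellW _ t)) in *.
    apply (Rlt_div_l _ _ v); [easy |].
    rewrite <- ellW_complement in Ev |- * by lra.
    set (s := sin t) in *.
    enough (r * (1 - r * s ^ 2) < r * v) by lra.
    apply Rmult_lt_compat_l; [easy |].
    assert ((1 - r * s ^ 2) ^ 2 < v ^ 2).
    { rewrite Ev. assert (0 < r * s ^ 2 * (2 - r * s ^ 2 - r)).
      { assert (0 < s ^ 2 < 1) by (simpl; nra).
        apply Rmult_lt_0_compat; [apply Rmult_lt_0_compat; lra | nra]. }
      nra. }
    assert (0 < s ^ 2 < 1) by (simpl; nra).
    assert (0 < 1 - r * s ^ 2) by nra. nra.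
Qed.

(** * Bounds of the denominator of [psi], and of [psi] itself *)

(** With [theta = t + atan (r * tan t)], the angle of Gauss' transformation, [(1 + r) * chord r t]
    is [sin theta] and [chord' r t] is [cos theta]. The prime marks a companion function, not a
    derivative. *)
Definition chord (r t : R) : R := sin t * cos t / sqrt (ellW r t).
Definition chord' (r t : R) : R := (cos t ^ 2 - r * sin t ^ 2) / sqrt (ellW r t).

Lemma is_derive_chord (r t : R) : 0 < r ->
  is_derive (fun t => chord r t) t
    ((cos t ^ 4 - r ^ 2 * sin t ^ 4) / sqrt (ellW r t) ^ 3).
Proof.
intros Hr; unfold chord.
destruct (sqrt_ellW r t Hr) as [Hv Ev]; pose proof (ellW_pos r t Hr) as Hw.
revert Hv Ev Hw; unfold ellW; intros Hv Ev Hw.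
auto_derive.
- repeat split; auto; apply Rgt_not_eq; assumption.
- change (cos t * (cos t * 1) + r * (r * 1) * (sin t * (sin t * 1)))
    with (cos t ^ 2 + r ^ 2 * sin t ^ 2).
  pose proof (cos2_sin2 t) as E.
  set (v := sqrt _) in *; rewrite E in Ev.
  field [E Ev]; lra.
Qed.

Lemma is_derive_chord' (r t : R) : 0 < r ->
  is_derive (fun t => chord' r t) t
    (- ((1 + r) ^ 2 * (sin t * cos t * (cos t ^ 2 + r * sin t ^ 2)))
     / sqrt (ellW r t) ^ 3).
Proof.
intros Hr; unfold chord'.
destruct (sqrt_ellW r t Hr) as [Hv Ev]; pose proof (ellW_pos r t Hr) as Hw.
revert Hv Ev Hw; unfold ellW; intros Hv Ev Hw.
auto_derive.
- repeat split; auto; apply Rgt_not_eq; assumption.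
- change (cos t * (cos t * 1) + r * (r * 1) * (sin t * (sin t * 1)))
    with (cos t ^ 2 + r ^ 2 * sin t ^ 2).
  pose proof (cos2_sin2 t) as E.
  set (v := sqrt _) in *; rewrite E in Ev.
  field [E Ev]; lra.
Qed.

Lemma chord_0 (r : R) : chord r 0 = 0.
Proof. unfold chord, Rdiv; rewrite sin_0; ring. Qed.

Lemma chord_PI2 (r : R) : chord r (PI / 2) = 0.
Proof. unfold chord, Rdiv at 1; rewrite cos_PI2; ring. Qed.

Lemma chord'_0 (r : R) : chord' r 0 = 1.
Proof.
unfold chord', ellW; rewrite sin_0, cos_0.
replace (1 ^ 2 + r ^ 2 * 0 ^ 2) with 1 by ring.
rewrite sqrt_1; field.
Qed.

Lemma chord'_PI2 (r : R) : 0 < r -> chord' r (PI / 2) = -1.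
Proof.
intros Hr; unfold chord', ellW; rewrite sin_PI2, cos_PI2.
replace (0 ^ 2 + r ^ 2 * 1 ^ 2) with (r * r) by ring.
rewrite sqrt_square by lra; field; lra.
Qed.

(* Adding a multiple of [chord] (zero at both ends) turns the integrand into
   [(1 - r)^2 / 2 * (c^2 - r s^2)^2 / w^(3/2)] with [w = c^2 + r^2 s^2]; then
   [c^2 + r s^2 <= sqrt w], and what remains is a rational function of [s^2]
   split into partial fractions. *)
Lemma psi_den_le (q : R) : 0 < q < 1 ->
  ellE' (q ^ 2) - q ^ 2 * ellK' (q ^ 2) <= PI / 2 * (1 - q) ^ 2.
Proof.
intros Hq; set (r := q ^ 2).
assert (Hr : 0 < r < 1) by (unfold r; nra).
rewrite psi_den_integral by easy.
assert (HR := PI_RGT_0).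
(* With [u = ellW q t] and [w = ellW r t], the first bracket is a primitive of [(1 - r) ^ 2 * (c ^ 2
   - r * s ^ 2) ^ 2 / (u * w)], by partial fractions; the [chord] term is the exact derivative taken
   back. *)
set (F := fun t => / 2 * ((1 + r) * t + r * (1 + r) * angle r t - 4 * r * angle q t)
   + (1 - r ^ 2) / 2 * chord r t).
replace (PI / 2 * (1 - q) ^ 2) with (F (PI / 2) - F 0)
  by (unfold F; rewrite !angle_0, !angle_PI2, chord_0, chord_PI2 by lra;
      unfold r; field; lra).
apply (RInt_le_primitive F
  (fun t => / 2 * ((1 + r) + r * (1 + r) * / ellW r t - 4 * r * / ellW q t)
   + (1 - r ^ 2) / 2 * ((cos t ^ 4 - r ^ 2 * sin t ^ 4) / sqrt (ellW r t) ^ 3))).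
- lra.
- intros; now apply continuous_ellW_sub.
- intros t _; unfold F.
  assert (H1 : is_derive (fun t => angle r t) t (/ ellW r t))
    by (apply is_derive_angle; lra).
  assert (H2 : is_derive (fun t => angle q t) t (/ ellW q t))
    by (apply is_derive_angle; lra).
  pose proof (is_derive_chord r t ltac:(lra)) as H3.
  auto_derive; [repeat split; eexists; eassumption |].
  replace (Derive (fun x : R => angle r x) t) with (/ ellW r t)
    by (symmetry; now apply is_derive_unique).
  replace (Derive (fun x : R => angle q x) t) with (/ ellW q t)
    by (symmetry; now apply is_derive_unique).
  replace (Derive (fun x : R => chord r x) t) with
    ((cos t ^ 4 - r ^ 2 * sin t ^ 4) / sqrt (ellW r t) ^ 3)
    by (symmetry; now apply is_derive_unique).
  unfold Rdiv; ring.
- intros t Ht.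
  destruct (sqrt_ellW r t ltac:(lra)) as [Hv Ev]; set (v := sqrt (ellW r t)) in *.
  pose proof (ellW_pos q t ltac:(lra)) as Hu.
  pose proof (cos2_sin2 t) as E.
  rewrite <- Ev.
  unfold ellW in Ev, Hu |- *; fold r in Hu |- *.
  set (s := sin t) in *; set (c := cos t) in *.
  set (u := c ^ 2 + r * s ^ 2) in *.
  assert (Huv : u <= v).
  { assert (u ^ 2 <= v ^ 2); [| nra].
    rewrite Ev; unfold u; rewrite E.
    assert (0 <= s ^ 2 * (1 - s ^ 2) * (1 - r) ^ 2); [| nra].
    rewrite <- E; apply Rmult_le_pos; [apply Rmult_le_pos |]; apply pow2_ge_0. }
  assert (0 <= (1 - r) ^ 2 / 2 * (c ^ 2 - r * s ^ 2) ^ 2 * (v - u) / (u * v ^ 3)).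
  { apply Rdiv_le_0_compat.
    - apply Rmult_le_pos; [apply Rmult_le_pos |]; try apply pow2_ge_0; [nra | lra].
    - apply Rmult_lt_0_compat; [| apply pow_lt]; lra. }
  match goal with |- ?x <= ?y =>
    enough (y - x = (1 - r) ^ 2 / 2 * (c ^ 2 - r * s ^ 2) ^ 2 * (v - u) / (u * v ^ 3))
      by lra
  end.
  clearbody v s c r; clear - Hv Ev Hu E.
  unfold u in *; rewrite E in Ev.
  field [E Ev]; lra.
Qed.

(* With [X = c] and [Y = q s], the same square satisfies
   [(X^2 - Y^2)^2 >= (X^2 + Y^2) (|X^2 - Y^2| - X Y)], and the right-hand side is
   exact on either side of [X = Y], that is, of [t0 = atan (1 / q)]. *)
Lemma psi_den_ge (q : R) : 0 < q < 1 ->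
  (1 - q) ^ 2 <= ellE' (q ^ 2) - q ^ 2 * ellK' (q ^ 2).
Proof.
intros Hq; set (r := q ^ 2).
assert (Hr : 0 < r < 1) by (unfold r; nra).
rewrite psi_den_integral by easy.
assert (HR := PI_RGT_0).
set (t0 := atan (/ q)).
assert (Ht0 : 0 < t0 < PI / 2).
{ split; [| apply atan_bound].
  rewrite <- atan_0; apply atan_increasing, Rinv_0_lt_compat; lra. }
destruct (sincos_pos t0 Ht0) as [Hs Hc].
assert (Hsc : cos t0 = q * sin t0).
{ assert (E : tan t0 = / q) by apply tan_atan.
  unfold tan in E.
  replace (cos t0) with (q * cos t0 * (sin t0 / cos t0) * cos t0 * / cos t0)
    at 1 by (rewrite E; field; lra).
  field; lra. }
assert (Hs2 : sin t0 ^ 2 = / (1 + r)).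
{ pose proof (cos2_sin2 t0) as E; rewrite Hsc in E.
  apply (Rmult_eq_reg_r (1 + r)); [| lra].
  rewrite Rinv_l by lra; unfold r; lra. }
assert (HW : sqrt (ellW r t0) = q).
{ replace (ellW r t0) with (q * q); [apply sqrt_square; lra |].
  unfold ellW; rewrite Hsc, Rpow_mult_distr, Hs2; unfold r; field; nra. }
assert (HS : chord r t0 = / (1 + r)).
{ unfold chord; rewrite HW, Hsc, <- Hs2; field; lra. }
(* [k] makes [(1 - r) * k * chord'] a primitive of the [X Y] term. The coefficient [(1 - r) * l] is
   the [(1 - r ^ 2) / 2] of the exact derivative plus or minus [(1 - r) ^ 2 / 2], with the sign of
   [X - Y]: [l = 1] before [t0], [l = r] after it. *)
set (k := (1 - r) / 2 * q / (1 + r) ^ 2).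
set (F := fun l t => (1 - r) * (l * chord r t + k * chord' r t)).
assert (HF : forall l t, is_derive (F l) t
  ((1 - r) * (l * (cos t ^ 4 - r ^ 2 * sin t ^ 4)
     - (1 - r) / 2 * q * (sin t * cos t * (cos t ^ 2 + r * sin t ^ 2)))
    / sqrt (ellW r t) ^ 3)).
{ intros l t; unfold F.
  destruct (sqrt_ellW r t ltac:(lra)) as [Hv _].
  pose proof (is_derive_chord r t ltac:(lra)) as H1.
  pose proof (is_derive_chord' r t ltac:(lra)) as H2.
  auto_derive; [repeat split; eexists; eassumption |].
  replace (Derive (fun x : R => chord r x) t) with
    ((cos t ^ 4 - r ^ 2 * sin t ^ 4) / sqrt (ellW r t) ^ 3)
    by (symmetry; now apply is_derive_unique).
  replace (Derive (fun x : R => chord' r x) t) with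
    (- ((1 + r) ^ 2 * (sin t * cos t * (cos t ^ 2 + r * sin t ^ 2)))
     / sqrt (ellW r t) ^ 3)
    by (symmetry; now apply is_derive_unique).
  unfold k; field; lra. }
assert (Hcont : forall x, continuous (fun t => (ellW r t - r) / sqrt (ellW r t)) x)
  by (intros; now apply continuous_ellW_sub).
set (g := fun t => (ellW r t - r) / sqrt (ellW r t)) in *.
rewrite <- (RInt_Chasles g 0 t0 (PI / 2))
  by now apply ex_RInt_continuous_R.
change (plus ?a ?b) with (a + b).
assert (H1 : F 1 t0 - F 1 0 <= RInt g 0 t0).
{ eapply RInt_ge_primitive; [easy | easy | intros; apply HF |].
  intros t Ht; destruct (sincos_pos t ltac:(lra)) as [Hst Hct].
  destruct (sqrt_ellW r t ltac:(lra)) as [Hv Ev].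
  unfold g; set (v := sqrt (ellW r t)) in *; rewrite <- Ev.
  pose proof (cos2_sin2 t) as E; unfold ellW in Ev.
  set (s := sin t) in *; set (c := cos t) in *.
  (* The gap in the inequality for the square is [Y (2 Y^3 + X (X - Y)^2)]; beyond [t0] the same
     expression appears with [X] and [Y] exchanged. *)
  assert (0 <= (1 - r) ^ 2 / 2 * (q * s * (2 * (q * s) ^ 3 + c * (c - q * s) ^ 2)) / v ^ 3).
  { apply Rdiv_le_0_compat; [| now apply pow_lt].
    apply Rmult_le_pos; [nra |].
    apply Rmult_le_pos; [nra |].
    apply Rplus_le_le_0_compat.
    - apply Rmult_le_pos; [lra | apply pow_le; nra].
    - apply Rmult_le_pos; [lra | apply pow2_ge_0]. }
  match goal with |- ?x <= ?y =>
    enough (y - x = (1 - r) ^ 2 / 2 * (q * s * (2 * (q * s) ^ 3 + c * (c - q * s) ^ 2)) / v ^ 3)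
      by lra
  end.
  unfold r in Ev |- *; clearbody v s c; clear - Hv Ev E.
  rewrite E in Ev.
  field [E Ev]; lra. }
assert (H2 : F r (PI / 2) - F r t0 <= RInt g t0 (PI / 2)).
{ eapply RInt_ge_primitive; [easy | easy | intros; apply HF |].
  intros t Ht; destruct (sincos_pos t ltac:(lra)) as [Hst Hct].
  destruct (sqrt_ellW r t ltac:(lra)) as [Hv Ev].
  unfold g; set (v := sqrt (ellW r t)) in *; rewrite <- Ev.
  pose proof (cos2_sin2 t) as E; unfold ellW in Ev.
  set (s := sin t) in *; set (c := cos t) in *.
  assert (0 <= (1 - r) ^ 2 / 2 * (c * (2 * c ^ 3 + q * s * (c - q * s) ^ 2)) / v ^ 3).
  { apply Rdiv_le_0_compat; [| now apply pow_lt].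
    apply Rmult_le_pos; [nra |].
    apply Rmult_le_pos; [nra |].
    apply Rplus_le_le_0_compat.
    - apply Rmult_le_pos; [lra | apply pow_le; nra].
    - apply Rmult_le_pos; [nra | apply pow2_ge_0]. }
  match goal with |- ?x <= ?y =>
    enough (y - x = (1 - r) ^ 2 / 2 * (c * (2 * c ^ 3 + q * s * (c - q * s) ^ 2)) / v ^ 3)
      by lra
  end.
  unfold r in Ev |- *; clearbody v s c; clear - Hv Ev E.
  rewrite E in Ev.
  field [E Ev]; lra. }
unfold F in H1, H2; rewrite HS in H1, H2.
rewrite chord_0, chord'_0 in H1; rewrite chord_PI2, chord'_PI2 in H2 by lra.
(* When the two estimates are added, the values of [chord'] at [t0] cancel, the jump of [l] leaves
   [(1 - r) ^ 2 * chord r t0], and the end values of [chord'] contribute [- 2 * (1 - r) * k]. *)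
apply Rle_trans with ((1 - r) ^ 2 * (/ (1 + r) - q / (1 + r) ^ 2)).
- enough (0 <= (1 - r) ^ 2 * (/ (1 + r) - q / (1 + r) ^ 2) - (1 - q) ^ 2) by lra.
  replace (_ - _) with (q * (1 - q) ^ 4 / (1 + r) ^ 2)
    by (unfold r; field; nra).
  apply Rdiv_le_0_compat; [apply Rmult_le_pos |]; try (apply pow_le; lra); try lra.
  apply pow_lt; lra.
- replace ((1 - r) ^ 2 * (/ (1 + r) - q / (1 + r) ^ 2)) with
   ((1 - r) * (1 * / (1 + r)) - (1 - r) * (k * 1)
     + ((1 - r) * (k * -1) - (1 - r) * (r * / (1 + r))))
   by (unfold k; field; lra).
  lra.
Qed.

(** Twice the least numerator over the largest denominator, and conversely, with [r = q ^ 2]; the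
    factors [PI / 2] of the two upper estimates produce [4 / PI] and [PI]. *)
Lemma psi_bounds (q : R) : 0 < q < 1 ->
  4 / PI * (q / (1 - q)) ^ 2 < psi (q ^ 2) < PI * (q / (1 - q)) ^ 2.
Proof.
intros Hq; unfold psi.
pose proof (psi_num_bounds (q ^ 2) ltac:(nra)) as HN.
pose proof (psi_den_le q Hq) as HD1; pose proof (psi_den_ge q Hq) as HD2.
assert (HR := PI_RGT_0).
set (N := ellE _ - _) in *; set (D := ellE' _ - _) in *.
assert (Hp : 0 < (1 - q) ^ 2) by (apply pow_lt; lra).
assert (Hq2 : 0 < q ^ 2) by (apply pow_lt; lra).
replace ((q / (1 - q)) ^ 2) with (q ^ 2 / (1 - q) ^ 2) by (field; lra).
split.
- apply (Rlt_div_r _ _ D); [lra |].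
  apply Rle_lt_trans with (4 / PI * (q ^ 2 / (1 - q) ^ 2) * (PI / 2 * (1 - q) ^ 2)).
  + apply Rmult_le_compat_l; [| easy].
    apply Rmult_le_pos; apply Rdiv_le_0_compat; lra.
  + replace (_ * _ * _) with (2 * q ^ 2) by (field; lra). lra.
- apply (Rlt_div_l _ _ D); [lra |].
  apply Rlt_le_trans with (PI * (q ^ 2 / (1 - q) ^ 2) * (1 - q) ^ 2).
  + replace (_ * _ * _) with (PI * q ^ 2) by (field; lra). lra.
  + apply Rmult_le_compat_l; [| easy].
    apply Rmult_le_pos; [lra |]; apply Rdiv_le_0_compat; lra.
Qed.

(** * Continuity in the modulus, surjectivity of [psi], bounds of [psi_inv] *)

Lemma RInt_lipschitz_continuity_pt (f : R -> R -> R) (a b x0 C d : R) :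
  a <= b -> 0 < d -> 0 <= C ->
  (forall x t, Rabs (x - x0) < d -> continuous (f x) t) ->
  (forall x t, Rabs (x - x0) < d -> Rabs (f x t - f x0 t) <= C * Rabs (x - x0)) ->
  continuity_pt (fun x => RInt (f x) a b) x0.
Proof.
intros Hab Hd HC Hcont Hlip.
assert (Hx0 : Rabs (x0 - x0) < d) by now rewrite Rminus_diag, Rabs_R0.
assert (Hex : forall x, Rabs (x - x0) < d -> ex_RInt (f x) a b)
  by (intros; apply ex_RInt_continuous_R; auto).
intros e He.
(* The added [1] keeps [M] positive even if [(b - a) * C] vanishes. *)
set (M := (b - a) * C + 1).
assert (HM : 0 < M) by (unfold M; nra).
exists (Rmin d (e / M)); split.
{ apply Rmin_pos; [easy | now apply Rdiv_lt_0_compat]. }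
intros x [_ Hx]; unfold R_dist, dist in Hx |- *; simpl in Hx |- *; unfold R_dist in Hx |- *.
assert (Hxd : Rabs (x - x0) < d) by (eapply Rlt_le_trans; [apply Hx | apply Rmin_l]).
assert (Hxe : Rabs (x - x0) < e / M) by (eapply Rlt_le_trans; [apply Hx | apply Rmin_r]).
change (RInt (f x) a b - RInt (f x0) a b)
  with (minus (RInt (f x) a b) (RInt (f x0) a b)).
rewrite <- (RInt_minus (f x) (f x0)) by auto.
apply Rle_lt_trans with ((b - a) * (C * Rabs (x - x0))).
- apply abs_RInt_le_const; [easy | |].
  + apply (ex_RInt_minus (f x) (f x0)); auto.
  + intros t _; now apply Hlip.
- apply (Rlt_div_r _ _ M) in Hxe; [| easy].
  pose proof (Rabs_pos (x - x0)); unfold M in Hxe; nra.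
Qed.

(** [ellW j t] is a convex combination of [1] and [j ^ 2], both at least [m ^ 2]. *)
Lemma ellW_ge (m j t : R) : 0 < m <= 1 -> m <= j -> m <= sqrt (ellW j t).
Proof.
intros Hm Hj; rewrite <- (sqrt_pow2 m) by lra.
apply sqrt_le_1_alt; unfold ellW; rewrite cos2_sin2.
pose proof (pow2_ge_0 (sin t)); pose proof (pow2_ge_0 (cos t)).
pose proof (cos2_sin2 t). assert (m ^ 2 <= j ^ 2) by nra. assert (m ^ 2 <= 1) by nra. nra.
Qed.

(** Triangle inequality: [sqrt (ellW j t)] is the Euclidean norm of [(cos t, j * sin t)], and
    changing [j] to [i] moves this vector by at most [Rabs (j - i)]. *)
Lemma sqrt_ellW_le (i j t : R) : 0 < i -> 0 < j ->
  sqrt (ellW j t) <= sqrt (ellW i t) + Rabs (j - i).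
Proof.
intros Hi Hj.
destruct (sqrt_ellW j t Hj) as [Hv Ev]; destruct (sqrt_ellW i t Hi) as [Hu Eu].
set (v := sqrt (ellW j t)) in *; set (u := sqrt (ellW i t)) in *.
pose proof (Rabs_pos (j - i)) as Ha.
assert (v ^ 2 <= (u + Rabs (j - i)) ^ 2); [| nra].
assert (Ed : Rabs (j - i) ^ 2 = (j - i) ^ 2) by apply pow2_abs.
replace ((u + Rabs (j - i)) ^ 2) with (u ^ 2 + 2 * (u * Rabs (j - i)) + Rabs (j - i) ^ 2) by ring.
rewrite Ed, Eu, Ev; unfold ellW.
pose proof (cos2_sin2 t); pose proof (pow2_ge_0 (cos t)); pose proof (pow2_ge_0 (sin t)).
assert (Hs : sin t ^ 2 <= 1) by lra.
assert (i * sin t ^ 2 <= u).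
{ assert ((i * sin t ^ 2) ^ 2 <= u ^ 2); [| nra].
  rewrite Eu; unfold ellW.
  replace ((i * sin t ^ 2) ^ 2) with (i ^ 2 * sin t ^ 2 * sin t ^ 2) by ring.
  assert (0 <= i ^ 2 * sin t ^ 2) by (apply Rmult_le_pos; [apply pow2_ge_0 | easy]).
  nra. }
assert (i * sin t ^ 2 * (j - i) <= u * Rabs (j - i)).
{ apply Rle_trans with (i * sin t ^ 2 * Rabs (j - i)).
  - apply Rmult_le_compat_l; [nra | apply Rle_abs].
  - now apply Rmult_le_compat_r. }
assert ((j - i) ^ 2 * sin t ^ 2 <= (j - i) ^ 2) by (pose proof (pow2_ge_0 (j - i)); nra).
nra.
Qed.

Lemma sqrt_ellW_lipschitz (i j t : R) : 0 < i -> 0 < j ->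
  Rabs (sqrt (ellW j t) - sqrt (ellW i t)) <= Rabs (j - i).
Proof.
intros Hi Hj; apply Rabs_le.
pose proof (sqrt_ellW_le i j t Hi Hj); pose proof (sqrt_ellW_le j i t Hj Hi) as H1.
rewrite Rabs_minus_sym in H1; lra.
Qed.

Lemma ellJ_continuity_pt (j : R) : 0 < j < 1 -> continuity_pt ellJ j.
Proof.
(* [m] is both the radius of the neighbourhood of [j] and a lower bound there for the square roots,
   whence the Lipschitz constant [/ m ^ 2] of their inverses. *)
intros Hj; set (m := j / 2).
apply (RInt_lipschitz_continuity_pt (fun j t => / sqrt (ellW j t)) _ _ _ (/ m ^ 2) m).
- generalize PI_RGT_0; lra.
- unfold m; lra.
- apply Rlt_le, Rinv_0_lt_compat, pow_lt; unfold m; lra.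
- intros x t Hx; apply Rabs_def2 in Hx.
  apply continuous_inv_sqrt_ellW; unfold m in Hx; lra.
- intros x t Hx; apply Rabs_def2 in Hx.
  pose proof (ellW_ge m x t ltac:(unfold m; lra) ltac:(unfold m in *; lra)) as H1.
  pose proof (ellW_ge m j t ltac:(unfold m; lra) ltac:(unfold m in *; lra)) as H2.
  pose proof (sqrt_ellW_lipschitz j x t ltac:(lra) ltac:(unfold m in *; lra)) as H3.
  set (v := sqrt (ellW x t)) in *; set (u := sqrt (ellW j t)) in *.
  assert (Hm : 0 < m) by (unfold m; lra).
  replace (/ v - / u) with (/ (v * u) * - (v - u)) by (field; lra).
  rewrite Rabs_mult, Rabs_Ropp, Rabs_pos_eq
    by (apply Rlt_le, Rinv_0_lt_compat; nra).
  apply Rmult_le_compat; [| apply Rabs_pos | | easy].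
  + apply Rlt_le, Rinv_0_lt_compat; nra.
  + apply Rinv_le_contravar; nra.
Qed.

Lemma ellE_continuity_pt (j : R) : 0 < j < 1 ->
  continuity_pt (fun j => RInt (fun t => sqrt (ellW j t)) 0 (PI / 2)) j.
Proof.
intros Hj.
apply (RInt_lipschitz_continuity_pt (fun j t => sqrt (ellW j t)) _ _ _ 1 j).
- generalize PI_RGT_0; lra.
- lra.
- lra.
- intros x t Hx; apply Rabs_def2 in Hx; apply continuous_sqrt_ellW; lra.
- intros x t Hx; apply Rabs_def2 in Hx.
  rewrite Rmult_1_l; apply sqrt_ellW_lipschitz; lra.
Qed.

Lemma ex_derive_continuity_pt (f : R -> R) (x : R) :
  ex_derive f x -> continuity_pt f x.
Proof.
intros H; apply (proj2 (continuity_pt_filterlim f x)).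
now apply ex_derive_continuous_R.
Qed.

(** Intermediate value theorem between two points at which [psi_bounds] places [psi] below and above
    [y]. *)
Lemma psi_surjective (y : R) : 0 < y -> exists r, 0 < r < 1 /\ psi r = y.
Proof.
intros Hy.
assert (HR := PI_RGT_0); assert (HR4 := PI2_3_2).
set (E := fun j => RInt (fun t => sqrt (ellW j t)) 0 (PI / 2)).
(* [psi] rewritten through [E] and [ellJ], functions of the complementary modulus whose continuity
   has been established. *)
set (G := fun r => 2 * (E (sqrt (1 - r ^ 2)) - (1 - r) * ellJ (sqrt (1 - r ^ 2)))
   / (E r - r * ellJ r) - y).
assert (HE : forall r, 0 < r < 1 -> E (sqrt (1 - r ^ 2)) = ellE r /\ E r = ellE' r).
{ intros r Hr; split; apply RInt_ext; intros t _.
  - now rewrite <- ellW_complement.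
  - now rewrite <- ellW_complement'. }
assert (HG : forall r, 0 < r < 1 -> G r = psi r - y).
{ intros r Hr; destruct (HE r Hr) as [E1 E2].
  unfold G, psi; now rewrite E1, E2, ellK_ellJ, ellK'_ellJ. }
assert (Hcont : forall r, 0 < r < 1 -> continuity_pt G r).
{ intros r Hr.
  assert (Hj : 0 < sqrt (1 - r ^ 2) < 1).
  { split; [apply sqrt_lt_R0; nra |]. apply sqrt_lt_of_sq; nra. }
  assert (H1 : continuity_pt (fun r => sqrt (1 - r ^ 2)) r).
  { apply (ex_derive_continuity_pt (fun r => sqrt (1 - r ^ 2))); auto_derive; nra. }
  assert (HJ : continuity_pt (fun r => ellJ (sqrt (1 - r ^ 2))) r)
    by (apply (continuity_pt_comp (fun r => sqrt (1 - r ^ 2)) ellJ); [easy |];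
        now apply ellJ_continuity_pt).
  assert (HE' : continuity_pt (fun r => E (sqrt (1 - r ^ 2))) r)
    by (apply (continuity_pt_comp (fun r => sqrt (1 - r ^ 2)) E); [easy |];
        now apply ellE_continuity_pt).
  assert (Hden : E r - r * ellJ r <> 0).
  { destruct (HE r Hr) as [_ ->]; rewrite <- ellK'_ellJ by easy.
    assert (Hq : 0 < sqrt r < 1) by (split; [apply sqrt_lt_R0 | apply sqrt_lt_of_sq]; lra).
    pose proof (psi_den_ge (sqrt r) Hq) as H; rewrite pow2_sqrt in H by lra.
    assert (0 < (1 - sqrt r) ^ 2) by (apply pow_lt; lra). lra. }
  assert (Hid : forall c, continuity_pt (fun r => c - r) r).
  { intros c; apply (ex_derive_continuity_pt (fun r => c - r)); now auto_derive. }
  apply (continuity_pt_minus (fun r => _ / _) (fun _ => y)).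
  2: { now apply continuity_pt_const. }
  apply (continuity_pt_div (fun r => 2 * _) (fun r => E r - r * ellJ r)); [| | easy].
  - apply (continuity_pt_scal (fun r => _ - _)).
    apply (continuity_pt_minus (fun r => E (sqrt (1 - r ^ 2)))
      (fun r => (1 - r) * ellJ (sqrt (1 - r ^ 2)))); [easy |].
    apply (continuity_pt_mult (fun r => 1 - r)); auto.
  - apply (continuity_pt_minus E (fun r => r * ellJ r)).
    + now apply ellE_continuity_pt.
    + apply (continuity_pt_mult (fun r => r) ellJ); [apply continuity_pt_id |].
      now apply ellJ_continuity_pt. }
(* In the variable [x = q / (1 - q)], these solve [PI * x ^ 2 = y] and [4 / PI * x ^ 2 = y];
   [x1 < x2] amounts to [4 < PI ^ 2]. *)
set (x1 := sqrt (y / PI)); set (x2 := sqrt (y * PI / 4)).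
assert (Hyp : 0 < y / PI) by (apply Rdiv_lt_0_compat; lra).
assert (Hx1 : 0 < x1) by now apply sqrt_lt_R0.
assert (Hx12 : x1 < x2).
{ apply sqrt_lt_1; try nra.
  apply (Rlt_div_l _ _ PI); [easy |].
  assert (4 < PI * PI) by nra.
  nra. }
assert (Hq : forall x, 0 < x -> 0 < x / (1 + x) < 1 /\
   x / (1 + x) / (1 - x / (1 + x)) = x).
{ intros x Hx; repeat split.
  - apply Rdiv_lt_0_compat; lra.
  - apply (Rlt_div_l _ _ (1 + x)); lra.
  - field; lra. }
destruct (Hq x1 Hx1) as [Hq1 E1]; destruct (Hq x2 ltac:(lra)) as [Hq2 E2].
pose proof (psi_bounds _ Hq1) as [_ B1]; pose proof (psi_bounds _ Hq2) as [B2 _].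
rewrite E1 in B1; rewrite E2 in B2.
assert (Ex1 : x1 ^ 2 = y / PI) by (apply pow2_sqrt; lra).
assert (Ex2 : x2 ^ 2 = y * PI / 4) by (apply pow2_sqrt; nra).
rewrite Ex1 in B1; rewrite Ex2 in B2.
assert (Hq12 : x1 / (1 + x1) < x2 / (1 + x2)).
{ apply (Rlt_div_l _ _ (1 + x1)); [lra |].
  replace (x2 / (1 + x2) * (1 + x1)) with (x2 * (1 + x1) / (1 + x2)) by (field; lra).
  apply (Rlt_div_r _ _ (1 + x2)); nra. }
set (q1 := x1 / (1 + x1)) in *; set (q2 := x2 / (1 + x2)) in *.
destruct (Ranalysis5.IVT_interv G (q1 ^ 2) (q2 ^ 2)) as [r [Hr Er]].
- intros a Ha; apply Hcont; nra.
- nra.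
- rewrite HG by nra. replace (PI * (y / PI)) with y in B1 by (field; lra). lra.
- rewrite HG by nra. replace (4 / PI * (y * PI / 4)) with y in B2 by (field; lra). lra.
- assert (Hr' : 0 < r < 1) by nra.
  exists r; split; [easy |]. rewrite HG in Er by easy. lra.
Qed.

Lemma psi_inv_spec (y : R) : 0 < y -> 0 < psi_inv y < 1 /\ psi (psi_inv y) = y.
Proof.
intros Hy.
apply (epsilon_spec (inhabits 0) (fun r => 0 < r < 1 /\ psi r = y)).
now apply psi_surjective.
Qed.

Lemma psi_inv_bounds (b : R) : 0 < b ->
  1 + sqrt (4 * b / PI) < / sqrt (psi_inv (1 / b)) < 1 + sqrt (PI * b).
Proof.
intros Hb; assert (HR := PI_RGT_0).
assert (Hy : 0 < 1 / b) by (apply Rdiv_lt_0_compat; lra).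
destruct (psi_inv_spec _ Hy) as [Hr Er].
set (r := psi_inv (1 / b)) in *.
set (q := sqrt r).
assert (Hq : 0 < q < 1)
  by (split; [apply sqrt_lt_R0 | apply sqrt_lt_of_sq]; lra).
pose proof (psi_bounds q Hq) as [B1 B2].
assert (Eq : q ^ 2 = r) by (apply pow2_sqrt; lra).
rewrite Eq, Er in B1, B2.
(* Since [q / (1 - q) = / x], the bounds of [psi] at this point become
   [4 * b / PI < x ^ 2 < PI * b]. *)
set (x := / q - 1).
assert (Ex : q / (1 - q) = / x) by (unfold x; field; lra).
assert (Hx : 0 < x).
{ assert (/ 1 < / q) by (apply Rinv_lt_contravar; lra).
  rewrite Rinv_1 in *; unfold x; lra. }
rewrite Ex in B1, B2.
replace (/ q) with (1 + x) by (unfold x; ring).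
assert (Hx2 : 0 < b * x ^ 2) by (apply Rmult_lt_0_compat; [| apply pow_lt]; lra).
apply (Rmult_lt_compat_r (b * x ^ 2)) in B1; [| easy].
apply (Rmult_lt_compat_r (b * x ^ 2)) in B2; [| easy].
replace (1 / b * (b * x ^ 2)) with (x * x) in B1, B2 by (field; lra).
replace (4 / PI * (/ x) ^ 2 * (b * x ^ 2)) with (4 * b / PI) in B1 by (field; lra).
replace (PI * (/ x) ^ 2 * (b * x ^ 2)) with (PI * b) in B2 by (field; lra).
assert (0 < 4 * b / PI) by (apply Rdiv_lt_0_compat; lra).
split; apply Rplus_lt_compat_l.
- apply sqrt_lt_of_sq; lra.
- rewrite <- (sqrt_square x) by lra; apply sqrt_lt_1; nra.
Qed.

(** * Logarithmic bounds of [ellJ] through the variable [x = tan t] *)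

(* The integrand of [ellJ r] in the variable [x = tan t]. *)
Definition tan_form (r x : R) : R := / sqrt ((1 + x ^ 2) * (1 + r ^ 2 * x ^ 2)).

Lemma tan_form_arg_pos (r x : R) : 0 < (1 + x ^ 2) * (1 + r ^ 2 * x ^ 2).
Proof.
pose proof (pow2_ge_0 x); pose proof (pow2_ge_0 r).
apply Rmult_lt_0_compat; nra.
Qed.

Lemma continuous_tan_form (r x : R) : continuous (tan_form r) x.
Proof.
pose proof (tan_form_arg_pos r x) as H; pose proof (sqrt_lt_R0 _ H).
apply ex_derive_continuous_R; unfold tan_form; auto_derive.
repeat split; auto; apply Rgt_not_eq; assumption.
Qed.

Lemma sqrt_eq (x y : R) : 0 <= y -> x = y ^ 2 -> sqrt x = y.
Proof. intros Hy ->; now apply sqrt_pow2. Qed.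

(* The integral over [0, +oo) is halved by the symmetry [x -> 1 / (r x)]. *)
Lemma ellJ_tan_form (q : R) : 0 < q < 1 -> ellJ (q ^ 2) = 2 * RInt (tan_form (q ^ 2)) 0 (/ q).
Proof.
intros Hq; set (r := q ^ 2).
assert (Hr : 0 < r < 1) by (unfold r; nra).
(* [/ q] is the fixed point of [x -> 1 / (r x)], so the symmetry exchanges the two sides of [t0]. *)
set (t0 := atan (/ q)).
assert (Ht0 : 0 < t0 < PI / 2).
{ split; [| apply atan_bound].
  rewrite <- atan_0; apply atan_increasing, Rinv_0_lt_compat; lra. }
assert (HR := PI_RGT_0).
assert (Ht : tan t0 = / q) by apply tan_atan.
destruct (sincos_pos t0 Ht0) as [Hs Hc].
unfold ellJ; set (g := fun t => / sqrt (ellW r t)).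
assert (Hg : forall x, continuous g x)
  by (intros; apply continuous_inv_sqrt_ellW; lra).
rewrite <- (RInt_Chasles g 0 t0 (PI / 2)) by now apply ex_RInt_continuous_R.
change (plus ?a ?b) with (a + b).
assert (H1 : RInt g 0 t0 = RInt (tan_form r) 0 (/ q)).
{ rewrite <- Ht; rewrite <- tan_0 at 2.
  rewrite <- (RInt_comp (tan_form r) tan (fun t => tan t ^ 2 + 1)).
  - apply RInt_ext; rewrite Rmin_left, Rmax_right by lra; intros t Htt.
    destruct (sincos_pos t ltac:(lra)) as [Hst Hct].
    unfold scal; simpl; unfold mult; simpl.
    destruct (sqrt_ellW r t ltac:(lra)) as [Hv Ev].
    unfold g, tan_form, tan; set (v := sqrt (ellW r t)) in *.
    pose proof (cos2_sin2 t) as E; unfold ellW in Ev.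
    set (s := sin t) in *; set (c := cos t) in *.
    assert (E1 : (s / c) ^ 2 + 1 = / c ^ 2) by (field [E]; lra).
    rewrite (sqrt_eq _ (v / c ^ 2)).
    + change (s / c * (s / c * 1) + 1) with ((s / c) ^ 2 + 1).
      rewrite E1; field; lra.
    + apply Rdiv_le_0_compat; [lra | apply pow_lt; lra].
    + rewrite (Rplus_comm 1 ((s / c) ^ 2)), E1.
      replace ((v / c ^ 2) ^ 2) with (v ^ 2 / c ^ 4) by (field; lra).
      rewrite Ev; field; lra.
  - intros; apply continuous_tan_form.
  - rewrite Rmin_left, Rmax_right by lra; intros t Htt.
    assert (0 < cos t) by (apply cos_gt_0; lra).
    split; [apply is_derive_tan; lra |].
    apply ex_derive_continuous_R; unfold tan; auto_derive; lra. }
assert (H2 : RInt g t0 (PI / 2) = RInt (tan_form r) 0 (/ q)).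
(* [h] is [tan] followed by the symmetry, written so as to be smooth at [PI / 2]. It is decreasing,
   hence the reversed bounds and the signs. *)
{ set (h := fun t => cos t / (r * sin t)).
  assert (E1 : h t0 = / q).
  { unfold h; replace (cos t0 / (r * sin t0)) with (/ (r * tan t0))
      by (unfold tan; field; lra).
    rewrite Ht; unfold r; field; lra. }
  assert (E2 : h (PI / 2) = 0) by (unfold h; rewrite cos_PI2; unfold Rdiv; ring).
  assert (E3 : RInt (tan_form r) 0 (/ q) = - RInt (tan_form r) (h t0) (h (PI / 2))).
  { rewrite E1, E2; symmetry; apply (opp_RInt_swap (tan_form r)).
    apply ex_RInt_continuous_R, continuous_tan_form. }
  rewrite E3, <- (RInt_comp (tan_form r) h (fun t => - / (r * sin t ^ 2))).
  - rewrite (RInt_ext (fun t => scal _ _) (fun t => opp (g t))).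
    + rewrite (RInt_opp g) by now apply ex_RInt_continuous_R.
      symmetry; apply Ropp_involutive.
    + rewrite Rmin_left, Rmax_right by lra; intros t Htt.
      destruct (sincos_pos t ltac:(lra)) as [Hst Hct].
      unfold scal, opp; simpl; unfold mult; simpl.
      destruct (sqrt_ellW r t ltac:(lra)) as [Hv Ev].
      unfold g, tan_form, h; set (v := sqrt (ellW r t)) in *.
      pose proof (cos2_sin2 t) as E; unfold ellW in Ev.
      set (s := sin t) in *; set (c := cos t) in *.
      assert (0 < r * s ^ 2) by (apply Rmult_lt_0_compat; [| apply pow_lt]; lra).
      rewrite (sqrt_eq _ (v / (r * s ^ 2))).
      * change (s * (s * 1)) with (s ^ 2); field; lra.
      * apply Rdiv_le_0_compat; lra.
      * replace (1 + r ^ 2 * (c / (r * s)) ^ 2) with (/ s ^ 2) by (field [E]; lra).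
        replace ((v / (r * s ^ 2)) ^ 2) with (v ^ 2 / (r ^ 2 * s ^ 4)) by (field; lra).
        rewrite Ev; field; lra.
  - intros; apply continuous_tan_form.
  - rewrite Rmin_left, Rmax_right by lra; intros t Htt.
    assert (0 < sin t) by (apply sin_gt_0; lra).
    assert (0 < r * sin t ^ 2) by (apply Rmult_lt_0_compat; [| apply pow_lt]; lra).
    assert (0 < r * sin t) by (apply Rmult_lt_0_compat; lra).
    pose proof (cos2_sin2 t) as E.
    split.
    + unfold h; auto_derive; [lra | field [E]; lra].
    + apply ex_derive_continuous_R; auto_derive; lra. }
rewrite H1, H2; ring.
Qed.

(** The left-hand side is the derivative of [arcsinh (x - r ^ 2 * x ^ 3 / 4)]. Squared and cleared
    of denominators, with [y = r ^ 2 * x ^ 2], the claim compares [(1 - 3 * y / 4) ^ 2 * (1 + y) *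
    (1 + x ^ 2)] with [1 + x ^ 2 * (1 - y / 4) ^ 2]; [A1] and [A2] settle the two coefficients in
    [x ^ 2]. *)
Lemma tan_form_lt (r x : R) : 0 < r -> 0 < x -> r * x ^ 2 < 1 -> r < 1 ->
  (1 - 3 * (r ^ 2 * x ^ 2) / 4) / sqrt ((x - r ^ 2 * x ^ 3 / 4) ^ 2 + 1) < tan_form r x.
Proof.
intros Hr Hx Hrx Hr1; unfold tan_form.
pose proof (tan_form_arg_pos r x) as Hp.
set (p := (1 + x ^ 2) * (1 + r ^ 2 * x ^ 2)) in *.
set (z := (x - r ^ 2 * x ^ 3 / 4) ^ 2 + 1).
assert (Hz : 0 < z) by (unfold z; pose proof (pow2_ge_0 (x - r ^ 2 * x ^ 3 / 4)); lra).
set (y := r ^ 2 * x ^ 2) in *.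
assert (Hx2 : 0 < x ^ 2) by (apply pow_lt; lra).
assert (Hy : 0 < y < 1).
{ replace y with (r * (r * x ^ 2)) by (unfold y; ring).
  assert (0 < r * x ^ 2) by (apply Rmult_lt_0_compat; lra). split; nra. }
pose proof (sqrt_lt_R0 _ Hz); pose proof (sqrt_lt_R0 _ Hp).
apply (Rmult_lt_reg_r (sqrt z * sqrt p)); [now apply Rmult_lt_0_compat |].
replace (/ sqrt p * (sqrt z * sqrt p)) with (sqrt z) by (field; lra).
replace (_ / _ * _) with ((1 - 3 * y / 4) * sqrt p) by (field; lra).
rewrite <- (sqrt_pow2 (1 - 3 * y / 4)) by lra.
rewrite <- sqrt_mult by (try apply pow2_ge_0; lra).
apply sqrt_lt_1; [apply Rmult_le_pos; [apply pow2_ge_0 | lra] | lra |].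
assert (A1 : (1 - 3 * y / 4) ^ 2 * (1 + y) < 1) by nra.
assert (A2 : (1 - 3 * y / 4) ^ 2 * (1 + y) < (1 - y / 4) ^ 2) by nra.
replace z with (1 + x ^ 2 * (1 - y / 4) ^ 2) by (unfold z, y; field).
unfold p; nra.
Qed.

(* [x - r^2 x^3 / 4] takes the value [1 / q - q / 4 = sinh (ln (2 / q))] at
   [x = 1 / q], so that its [arcsinh] there is exactly [ln (2 / q)]. *)
Lemma ellJ_gt_ln (r : R) : 0 < r < 1 -> ln (4 / r) < ellJ r.
Proof.
intros Hr; set (q := sqrt r).
assert (Hq : 0 < q < 1) by (split; [apply sqrt_lt_R0 | apply sqrt_lt_of_sq]; lra).
assert (Eq : r = q ^ 2) by (symmetry; apply pow2_sqrt; lra).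
assert (Hiq : 1 < / q).
{ rewrite <- Rinv_1; apply Rinv_lt_contravar; lra. }
assert (H : ln (2 / q) < RInt (tan_form r) 0 (/ q)).
{ set (F := fun x => arcsinh (x - r ^ 2 * x ^ 3 / 4)).
  replace (ln (2 / q)) with (F (/ q) - F 0).
  - apply (RInt_gt_primitive F
      (fun x => (1 - 3 * (r ^ 2 * x ^ 2) / 4) / sqrt ((x - r ^ 2 * x ^ 3 / 4) ^ 2 + 1))).
    + lra.
    + intros; apply continuous_tan_form.
    + intros x _; unfold F.
      replace (_ / _) with ((1 - 3 * (r ^ 2 * x ^ 2) / 4) * / sqrt ((x - r ^ 2 * x ^ 3 / 4) ^ 2 + 1))
        by reflexivity.
      apply (is_derive_comp arcsinh (fun x => x - r ^ 2 * x ^ 3 / 4)).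
      * apply is_derive_Reals, derivable_pt_lim_arcsinh.
      * auto_derive; [easy | field].
    + intros x Hx; apply tan_form_lt; try lra.
      assert (q * x < 1).
      { replace 1 with (q * / q) by (field; lra). apply Rmult_lt_compat_l; lra. }
      rewrite Eq. replace (q ^ 2 * x ^ 2) with ((q * x) ^ 2) by ring.
      assert (0 < q * x) by (apply Rmult_lt_0_compat; lra). nra.
  - unfold F. replace (0 - r ^ 2 * 0 ^ 3 / 4) with 0 by field.
    rewrite arcsinh_0, Rminus_0_r.
    replace (/ q - _) with (sinh (ln (2 / q))); [apply arcsinh_sinh |].
    assert (0 < 2 / q) by (apply Rdiv_lt_0_compat; lra).
    unfold sinh; rewrite exp_Ropp, exp_ln by easy.
    rewrite Eq; field; lra. }
rewrite Eq at 2; rewrite ellJ_tan_form, <- Eq by easy.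
replace (4 / r) with (2 / q * (2 / q)) by (rewrite Eq; field; lra).
rewrite ln_mult by (apply Rdiv_lt_0_compat; lra). lra.
Qed.

(** Dropping the factor [1 + r ^ 2 * x ^ 2] leaves [2 * arcsinh (/ q) <= 2 * ln (3 / q)], and
    [9 / r = 4 / r * (9 / 4)]. The constant is crude because the iteration in [mu_le_iter] removes
    it. *)
Lemma ellJ_le_ln (r : R) : 0 < r < 1 -> ellJ r <= ln (4 / r) + ln (9 / 4).
Proof.
intros Hr; set (q := sqrt r).
assert (Hq : 0 < q < 1) by (split; [apply sqrt_lt_R0 | apply sqrt_lt_of_sq]; lra).
assert (Eq : r = q ^ 2) by (symmetry; apply pow2_sqrt; lra).
assert (Hiq : 1 < / q).
{ rewrite <- Rinv_1; apply Rinv_lt_contravar; lra. }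
assert (H : RInt (tan_form r) 0 (/ q) <= arcsinh (/ q) - arcsinh 0).
{ apply (RInt_le_primitive arcsinh (fun x => / sqrt (x ^ 2 + 1))).
  - lra.
  - intros; apply continuous_tan_form.
  - intros; apply is_derive_Reals, derivable_pt_lim_arcsinh.
  - intros x _; unfold tan_form.
    pose proof (pow2_ge_0 x); pose proof (pow2_ge_0 r).
    apply Rinv_le_contravar; [apply sqrt_lt_R0; lra |].
    apply sqrt_le_1_alt.
    assert (0 <= r ^ 2 * x ^ 2) by now apply Rmult_le_pos. nra. }
rewrite arcsinh_0, Rminus_0_r in H.
assert (H3 : arcsinh (/ q) <= ln (3 / q)).
{ unfold arcsinh; apply Rcomplements.ln_le.
  - pose proof (sqrt_pos ((/ q) ^ 2 + 1)); lra.
  - assert (sqrt ((/ q) ^ 2 + 1) <= 2 * / q).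
    { rewrite <- (sqrt_pow2 (2 * / q)) by lra. apply sqrt_le_1_alt; nra. }
    unfold Rdiv; lra. }
rewrite Eq at 1; rewrite ellJ_tan_form, <- Eq by easy.
rewrite <- ln_mult; [| apply Rdiv_lt_0_compat; lra | lra].
replace (4 / r * (9 / 4)) with (3 / q * (3 / q)) by (rewrite Eq; field; lra).
rewrite ln_mult by (apply Rdiv_lt_0_compat; lra). lra.
Qed.

(** * Gauss' transformation *)

(** Reflection [t -> PI - t]. The substitution in [ellJ_gauss] maps [[0, PI / 2]] onto [[0, PI]]. *)
Lemma RInt_0_PI (g : R) : 0 < g ->
  RInt (fun t => / sqrt (ellW g t)) 0 PI = 2 * ellJ g.
Proof.
intros Hg; set (f := fun t => / sqrt (ellW g t)).
assert (Hf : forall x, continuous f x)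
  by (intros; now apply continuous_inv_sqrt_ellW).
rewrite <- (RInt_Chasles f 0 (PI / 2) PI) by now apply ex_RInt_continuous_R.
change (plus ?a ?b) with (a + b).
assert (H : RInt f (PI / 2) PI = RInt f 0 (PI / 2)).
{ pose proof (RInt_comp_lin f (-1) PI (PI / 2) 0) as H.
  replace (-1 * (PI / 2) + PI) with (PI / 2) in H by field.
  replace (-1 * 0 + PI) with PI in H by ring.
  rewrite <- H by now apply ex_RInt_continuous_R.
  rewrite <- (opp_RInt_swap f) by now apply ex_RInt_continuous_R.
  rewrite <- (RInt_opp f) by now apply ex_RInt_continuous_R.
  apply RInt_ext; intros t _; change (-1 * f (-1 * t + PI) = - f t).
  unfold f, ellW; replace (-1 * t + PI) with (PI - t) by ring.
  rewrite Rtrigo_facts.sin_pi_minus, Rtrigo_facts.cos_pi_minus.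
  replace ((- cos t) ^ 2) with (cos t ^ 2) by ring.
  ring. }
rewrite H; apply Rplus_diag.
Qed.

(* Gauss' transformation, by the substitution tan (theta - t) = j tan t. *)
Lemma ellJ_gauss (j : R) : 0 < j < 1 -> (1 + j) * ellJ j = 2 * ellJ (2 * sqrt j / (1 + j)).
Proof.
intros Hj; set (g := 2 * sqrt j / (1 + j)).
assert (Hq : 0 < sqrt j) by (apply sqrt_lt_R0; lra).
assert (Hg : 0 < g) by (apply Rdiv_lt_0_compat; lra).
assert (Eg : g ^ 2 = 4 * j / (1 + j) ^ 2).
{ unfold g; replace ((2 * sqrt j / (1 + j)) ^ 2) with (4 * sqrt j ^ 2 / (1 + j) ^ 2)
    by (field; lra). rewrite pow2_sqrt; lra. }
assert (HR := PI_RGT_0).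
rewrite <- RInt_0_PI by easy.
set (f := fun t => / sqrt (ellW g t)).
set (theta := fun t => t + j * angle j t).
assert (E0 : theta 0 = 0) by (unfold theta; rewrite angle_0 by lra; ring).
assert (E1 : theta (PI / 2) = PI)
  by (unfold theta; rewrite angle_PI2 by lra; field; lra).
rewrite <- E0, <- E1.
rewrite <- (RInt_comp f theta (fun t => 1 + j * / ellW j t)).
- unfold ellJ; change ((1 + j) * ?x) with (scal (1 + j) x).
  rewrite <- (RInt_scal (fun t => / sqrt (ellW j t)))
    by (apply ex_RInt_continuous_R; intros; apply continuous_inv_sqrt_ellW; lra).
  apply RInt_ext; intros t _.
  unfold scal; simpl; unfold mult; simpl.
  destruct (sqrt_ellW j t ltac:(lra)) as [Hv Ev].
  set (u := cos t ^ 2 + j * sin t ^ 2).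
  assert (Hu : 0 < u).
  { unfold u; pose proof (ellW_pos (sqrt j) t Hq) as H; unfold ellW in H.
    rewrite pow2_sqrt in H; lra. }
  (* With [v = sqrt (ellW j t)], the derivative of [theta] is [(1 + j) * u / v ^ 2], so dividing it
     by [u / v] leaves [(1 + j) / v]. *)
  assert (Ew : sqrt (ellW g (theta t)) = u / sqrt (ellW j t)).
  { apply sqrt_eq; [apply Rdiv_le_0_compat; lra |].
    unfold ellW at 1, theta, angle; fold u.
    replace (t + j * _) with
      (2 * t - atan ((1 - j) * (sin t * cos t) / u)) by (field; lra).
    rewrite cos_minus, sin_minus, cos_2a, sin_2a, cos_atan, sin_atan.
    pose proof (cos2_sin2 t) as E.
    assert (Ea : sqrt (1 + Rsqr ((1 - j) * (sin t * cos t) / u)) = sqrt (ellW j t) / u).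
    { apply sqrt_eq; [apply Rdiv_le_0_compat; lra |].
      replace ((sqrt (ellW j t) / u) ^ 2) with (sqrt (ellW j t) ^ 2 / u ^ 2) by (field; lra).
      rewrite Ev; unfold Rsqr, ellW.
      unfold u in *. field [E]. lra. }
    rewrite Ea, Eg; set (v := sqrt (ellW j t)) in *.
    unfold ellW in Ev; unfold u in *; set (s := sin t) in *; set (c := cos t) in *.
    clearbody v s c; clear - Hv Ev E Hu Hj. rewrite E in Ev.
    field [E Ev]; lra. }
  unfold f; rewrite Ew; set (v := sqrt (ellW j t)) in *; rewrite <- Ev.
  replace (1 + j * / v ^ 2) with ((v ^ 2 + j) / v ^ 2) by (field; lra).
  replace (v ^ 2 + j) with ((1 + j) * u).
  + field; lra.
  + rewrite Ev; unfold u, ellW; rewrite cos2_sin2; ring.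
- intros; now apply continuous_inv_sqrt_ellW.
- intros t _; split.
  + unfold theta.
    assert (HA : is_derive (fun t => angle j t) t (/ ellW j t))
      by (apply is_derive_angle; lra).
    auto_derive; [now exists (/ ellW j t) |].
    replace (Derive (fun x : R => angle j x) t) with (/ ellW j t)
      by (symmetry; now apply is_derive_unique).
    ring.
  + pose proof (ellW_pos j t ltac:(lra)) as Hw; revert Hw; unfold ellW; intros Hw.
    apply ex_derive_continuous_R; auto_derive; apply Rgt_not_eq; assumption.
Qed.

(** * Bounds of [mu] and the descending Landen transform *)

Lemma ellJ_ge (j : R) : 0 < j < 1 -> PI / 2 <= ellJ j.
Proof.
intros Hj; assert (HR := PI_RGT_0).
replace (PI / 2) with (PI / 2 - 0) at 1 by ring.
apply (RInt_ge_primitive (fun t => t) (fun _ => 1)).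
- lra.
- intros; apply continuous_inv_sqrt_ellW; lra.
- intros; auto_derive; auto.
- intros t _; destruct (sqrt_ellW j t ltac:(lra)) as [Hv Ev].
  rewrite <- Rinv_1; apply Rinv_le_contravar; [easy |].
  rewrite <- sqrt_1; apply sqrt_le_1_alt; unfold ellW.
  rewrite cos2_sin2; pose proof (pow2_ge_0 (sin t)).
  assert (j ^ 2 <= 1) by nra; nra.
Qed.

Lemma complement_bounds (r : R) : 0 < r < 1 ->
  0 < sqrt (1 - r ^ 2) < 1 /\ sqrt (1 - r ^ 2) ^ 2 = 1 - r ^ 2.
Proof.
intros Hr; repeat split.
- apply sqrt_lt_R0; nra.
- apply sqrt_lt_of_sq; nra.
- apply pow2_sqrt; nra.
Qed.

Lemma mu_ellJ (r : R) : 0 < r < 1 -> mu r = PI / 2 * (ellJ r / ellJ (sqrt (1 - r ^ 2))).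
Proof. intros Hr; unfold mu; now rewrite ellK_ellJ, ellK'_ellJ. Qed.

Lemma mu_gt (r : R) : 0 < r < 1 -> sqrt (sqrt (1 - r ^ 2)) * ln (4 / r) < mu r.
Proof.
intros Hr; rewrite mu_ellJ by easy.
destruct (complement_bounds r Hr) as [Hj _]; set (j := sqrt (1 - r ^ 2)) in *.
pose proof (ellJ_le j Hj) as H1; pose proof (ellJ_ge j Hj) as H2.
pose proof (ellJ_gt_ln r Hr) as H3; assert (HR := PI_RGT_0).
assert (Hq : 0 < sqrt j) by (apply sqrt_lt_R0; lra).
assert (Hln : 0 < ln (4 / r)).
{ rewrite <- ln_1; apply ln_increasing; [lra |].
  apply (Rlt_div_r _ _ r); lra. }
replace (PI / 2 * (ellJ r / ellJ j)) with (PI / 2 * ellJ r / ellJ j) by (field; lra).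
apply (Rlt_div_r _ _ (ellJ j)); [lra |].
apply Rle_lt_trans with (sqrt j * ln (4 / r) * (PI / (2 * sqrt j))).
- apply Rmult_le_compat_l; [| easy]. apply Rmult_le_pos; lra.
- replace (_ * _ * _) with (PI / 2 * ln (4 / r)) by (field; lra).
  apply Rmult_lt_compat_l; lra.
Qed.

Definition landen (r : R) : R := (1 - sqrt (1 - r ^ 2)) / (1 + sqrt (1 - r ^ 2)).

Lemma landen_bounds (r : R) : 0 < r < 1 -> 0 < landen r < 1.
Proof.
intros Hr; destruct (complement_bounds r Hr) as [Hj _]; unfold landen.
set (j := sqrt (1 - r ^ 2)) in *; split.
- apply Rdiv_lt_0_compat; lra.
- apply (Rlt_div_l _ _ (1 + j)); lra.
Qed.

(** Gauss' transformation at [landen r] returns to [r]; at [j = sqrt (1 - r ^ 2)] it leads to the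
    complement of [landen r]. In the quotient the factors combine through
    [(1 + landen r) * (1 + j) = 2]. *)
Lemma mu_landen (r : R) : 0 < r < 1 -> mu r = mu (landen r) / 2.
Proof.
intros Hr; pose proof (landen_bounds r Hr) as Hl.
rewrite !mu_ellJ by easy.
destruct (complement_bounds r Hr) as [Hj Ej].
pose proof (ellJ_gauss _ Hl) as H1; pose proof (ellJ_gauss _ Hj) as H2.
assert (E1 : 2 * sqrt (landen r) / (1 + landen r) = r).
{ replace (sqrt (landen r)) with (r / (1 + sqrt (1 - r ^ 2))).
  - unfold landen; field; lra.
  - symmetry; apply sqrt_eq; [apply Rdiv_le_0_compat; lra |].
    unfold landen; set (j := sqrt (1 - r ^ 2)) in *.
    replace ((r / (1 + j)) ^ 2) with (r ^ 2 / (1 + j) ^ 2) by (field; lra).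
    replace (r ^ 2) with (1 - j ^ 2) by lra. field; lra. }
assert (E2 : sqrt (1 - landen r ^ 2) =
  2 * sqrt (sqrt (1 - r ^ 2)) / (1 + sqrt (1 - r ^ 2))).
{ unfold landen; set (j := sqrt (1 - r ^ 2)) in *.
  assert (Eq : sqrt j ^ 2 = j) by (apply pow2_sqrt; lra).
  apply sqrt_eq; [pose proof (sqrt_pos j); apply Rdiv_le_0_compat; lra |].
  replace ((2 * sqrt j / (1 + j)) ^ 2) with (4 * sqrt j ^ 2 / (1 + j) ^ 2) by (field; lra).
  rewrite Eq; field; lra. }
rewrite E1 in H1; rewrite <- E2 in H2.
destruct (complement_bounds _ Hl) as [Hjl _].
pose proof (ellJ_ge _ Hj); pose proof (ellJ_ge _ Hjl); assert (HR := PI_RGT_0).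
set (j := sqrt (1 - r ^ 2)) in *.
replace (ellJ (sqrt (1 - landen r ^ 2))) with ((1 + j) * ellJ j / 2) by lra.
replace (ellJ (landen r)) with (2 * ellJ r / (1 + landen r)) by (rewrite <- H1; field; lra).
unfold landen; fold j; field; lra.
Qed.

Lemma ln_landen (r : R) : 0 < r < 1 ->
  ln (4 / landen r) / 2 = ln (2 * (1 + sqrt (1 - r ^ 2)) / r).
Proof.
intros Hr; destruct (complement_bounds r Hr) as [Hj Ej]; unfold landen.
set (j := sqrt (1 - r ^ 2)) in *.
assert (0 < 2 * (1 + j) / r) by (apply Rdiv_lt_0_compat; lra).
replace (4 / ((1 - j) / (1 + j))) with (2 * (1 + j) / r * (2 * (1 + j) / r)).
- rewrite ln_mult by easy; field.
- replace (2 * (1 + j) / r * (2 * (1 + j) / r)) with (4 * (1 + j) ^ 2 / r ^ 2)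
    by (field; lra).
  replace (r ^ 2) with ((1 - j) * (1 + j)) by (ring_simplify; lra).
  field; lra.
Qed.

Lemma ln_landen_lt (r : R) : 0 < r < 1 ->
  ln (2 * (1 + sqrt (1 - r ^ 2)) / r) < ln (4 / r).
Proof.
intros Hr; destruct (complement_bounds r Hr) as [Hj _].
apply ln_increasing; [apply Rdiv_lt_0_compat; lra |].
apply Rmult_lt_compat_r; [apply Rinv_0_lt_compat |]; lra.
Qed.

(** The case [n = 0] is [ellJ_le_ln] with [PI / 2] as lower bound of [K]. Each further step applies
    the bound at [landen r], which halves both [mu] and the error. *)
Lemma mu_le_iter (n : nat) (r : R) : 0 < r < 1 ->
  mu r <= ln (4 / r) + ln (9 / 4) / 2 ^ n.
Proof.
revert r; induction n as [| n IH]; intros r Hr.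
- rewrite mu_ellJ by easy; simpl; rewrite (Rdiv_1_r (ln (9 / 4))).
  apply Rle_trans with (ellJ r); [| now apply ellJ_le_ln].
  destruct (complement_bounds r Hr) as [Hj _].
  pose proof (ellJ_ge _ Hj) as H1; pose proof (ellJ_ge r Hr) as H2.
  assert (HR := PI_RGT_0).
  set (k := ellJ (sqrt _)) in *.
  replace (PI / 2 * (ellJ r / k)) with (PI / 2 * ellJ r / k) by (field; lra).
  apply (Rle_div_l _ _ k); [lra |]. rewrite Rmult_comm.
  apply Rmult_le_compat_l; lra.
- rewrite mu_landen by easy.
  pose proof (IH _ (landen_bounds r Hr)) as H.
  pose proof (ln_landen r Hr); pose proof (ln_landen_lt r Hr).
  replace (ln (9 / 4) / 2 ^ S n) with (ln (9 / 4) / 2 ^ n / 2)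
    by (simpl; field; apply pow_nonzero; lra).
  lra.
Qed.

Lemma mu_le (r : R) : 0 < r < 1 -> mu r <= ln (4 / r).
Proof.
intros Hr.
apply (is_lim_seq_le (fun _ => mu r)
  (fun n => ln (4 / r) + ln (9 / 4) * (/ 2) ^ n) (mu r) (ln (4 / r))).
- intros n; rewrite pow_inv; now apply mu_le_iter.
- apply is_lim_seq_const.
- replace (Finite (ln (4 / r))) with (Finite (ln (4 / r) + ln (9 / 4) * 0))
    by (f_equal; ring).
  apply is_lim_seq_plus'; [apply is_lim_seq_const |].
  apply (is_lim_seq_scal_l (fun n => (/ 2) ^ n) (ln (9 / 4)) 0).
  apply is_lim_seq_geom; rewrite Rabs_pos_eq; lra.
Qed.

(** The limit in [mu_le] loses strictness. One Landen step gives the sharper bound in weak form; at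
    [landen r] that bound is strictly below [ln (4 / landen r)], so a second step makes the
    inequality strict. *)
Lemma mu_lt (r : R) : 0 < r < 1 -> mu r < ln (2 * (1 + sqrt (1 - r ^ 2)) / r).
Proof.
assert (H : forall r, 0 < r < 1 -> mu r <= ln (2 * (1 + sqrt (1 - r ^ 2)) / r)).
{ intros s Hs; rewrite mu_landen, <- ln_landen by easy.
  pose proof (mu_le _ (landen_bounds s Hs)); lra. }
intros Hr; rewrite mu_landen, <- ln_landen by easy.
pose proof (H _ (landen_bounds r Hr)).
pose proof (ln_landen_lt _ (landen_bounds r Hr)); lra.
Qed.

(** * Transfer of the bounds of [mu] to the parameter [b] *)

Theorem theorem4p3 :
  forall b : R, 0 < b ->
    lower_bound b < modulus_Gamma b < upper_bound b
    /\ lower_bound b > 2 / PI * (1 - / (1 + sqrt (4 * b / PI)))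
                       * ln (2 * (1 + sqrt (4 * b / PI)))
    /\ upper_bound b < 2 / PI * ln (2 * (1 + sqrt (PI * b))).
Proof.
intros b Hb.
destruct (psi_inv_bounds b Hb) as [B1 B2].
assert (HR := PI_RGT_0).
destruct (psi_inv_spec (1 / b)) as [Hr _]; [apply Rdiv_lt_0_compat; lra |].
unfold lower_bound, upper_bound, modulus_Gamma.
assert (Hx : 0 < sqrt (4 * b / PI)) by (apply sqrt_lt_R0, Rdiv_lt_0_compat; lra).
assert (Hy : 0 < sqrt (PI * b)) by (apply sqrt_lt_R0; nra).
set (x := 1 + sqrt (4 * b / PI)) in *; set (y := 1 + sqrt (PI * b)) in *.
assert (Hx1 : 1 < x) by (unfold x; lra).
assert (Hy1 : 1 < y) by (unfold y; lra).
set (r := psi_inv (1 / b)) in *.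
assert (Hp : 0 < / PI) by now apply Rinv_0_lt_compat.
clearbody x y r; clear Hx Hy.
(* In terms of [z] the location of [r] reads [x < z < y], while [4 / r = (2 * z) ^ 2] and
   [r ^ 2 = / z ^ 4]; both bounds of [mu] increase with [z]. *)
set (z := / sqrt r) in *.
assert (Hq : 0 < sqrt r) by (apply sqrt_lt_R0; lra).
assert (Ez : / r = z ^ 2).
{ unfold z; rewrite pow_inv, pow2_sqrt by lra; reflexivity. }
assert (Hinv : forall u, 1 < u -> 0 < / u ^ 4 < 1).
{ intros u Hu; assert (1 < u ^ 4) by (apply Rlt_pow_R1; [lra | auto with arith]).
  split; [apply Rinv_0_lt_compat; lra |].
  rewrite <- Rinv_1; apply Rinv_lt_contravar; lra. }
assert (Hlnx : 0 < ln (2 * x)) by (rewrite <- ln_1; apply ln_increasing; lra).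
pose proof (Hinv x Hx1) as Hix; pose proof (Hinv y Hy1) as Hiy.
assert (Er2 : r ^ 2 = / z ^ 4).
{ replace (z ^ 4) with ((z ^ 2) ^ 2) by ring; rewrite <- Ez, pow_inv, Rinv_inv; reflexivity. }
(* The fourth root as a nested square root, the form in which [mu_gt] provides it. *)
assert (ER : Rpower (1 - / x ^ 4) (1 / 4) = sqrt (sqrt (1 - / x ^ 4))).
{ rewrite <- (Rpower_sqrt (sqrt _)) by (apply sqrt_lt_R0; lra).
  rewrite <- Rpower_sqrt by lra.
  rewrite Rpower_mult; f_equal; field. }
rewrite ER.
assert (Hpow : forall u v, 1 < u -> u < v -> / v ^ 4 < / u ^ 4).
{ intros u v Hu Huv.
  apply Rinv_lt_contravar; [apply Rmult_lt_0_compat; apply pow_lt; lra |].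
  assert (u ^ 2 < v ^ 2) by nra; assert (0 < u ^ 2) by nra.
  replace (u ^ 4) with (u ^ 2 * u ^ 2) by ring.
  replace (v ^ 4) with (v ^ 2 * v ^ 2) by ring. nra. }
pose proof (Hpow x z Hx1 B1) as Hzx.
pose proof (Hpow z y ltac:(lra) B2) as Hzy.
repeat split.
- pose proof (mu_gt r Hr) as H; rewrite Er2 in H.
  apply Rlt_trans with (1 / PI * (sqrt (sqrt (1 - / z ^ 4)) * ln (4 / r))).
  2: { apply Rmult_lt_compat_l; [lra | easy]. }
  (* The factor [2] enters the logarithm as a square, to match [4 / r = (2 * z) ^ 2]. *)
  replace (2 / PI * sqrt (sqrt (1 - / x ^ 4)) * ln (2 * x))
    with (1 / PI * (sqrt (sqrt (1 - / x ^ 4)) * ln (2 * x * (2 * x))))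
    by (rewrite ln_mult by lra; field; lra).
  apply Rmult_lt_compat_l; [lra |].
  apply Rmult_gt_0_lt_compat.
  + rewrite ln_mult; lra.
  + apply sqrt_lt_R0, sqrt_lt_R0; lra.
  + apply sqrt_lt_1; try apply sqrt_pos; apply sqrt_lt_1; lra.
  + apply ln_increasing; unfold Rdiv; rewrite ?Ez; nra.
- pose proof (mu_lt r Hr) as H; rewrite Er2 in H.
  apply Rlt_trans with (1 / PI * ln (2 * (1 + sqrt (1 - / z ^ 4)) / r)).
  { apply Rmult_lt_compat_l; [lra | easy]. }
  apply Rmult_lt_compat_l; [lra |].
  unfold Rdiv; rewrite Ez.
  pose proof (sqrt_pos (1 - / z ^ 4)).
  assert (sqrt (1 - / z ^ 4) < sqrt (1 - / y ^ 4)) by (apply sqrt_lt_1; lra).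
  assert (1 < z ^ 2 < y ^ 2) by nra.
  apply ln_increasing.
  + apply Rmult_lt_0_compat; lra.
  + rewrite Rmult_assoc, (Rmult_comm _ (z ^ 2)), <- Rmult_assoc.
    apply Rmult_gt_0_lt_compat; lra.
- apply Rmult_lt_compat_r; [easy |].
  apply Rmult_lt_compat_l; [apply Rdiv_lt_0_compat; lra |].
  assert (Hw : 0 < / x < 1).
  { split; [apply Rinv_0_lt_compat; lra |].
    rewrite <- Rinv_1; apply Rinv_lt_contravar; lra. }
  rewrite <- pow_inv; set (w := / x) in *.
  (* [1 - w] is written as the fourth root of its fourth power, so that the claim reduces to
     [(1 - w) ^ 4 < 1 - w < 1 - w ^ 4]. *)
  rewrite <- (sqrt_pow2 (1 - w)) by lra.
  rewrite <- (sqrt_pow2 ((1 - w) ^ 2)) by apply pow2_ge_0.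
  assert (w ^ 4 < w) by (assert (w ^ 3 < 1) by (apply pow_lt_1_compat; [lra | auto with arith]); nra).
  assert (((1 - w) ^ 2) ^ 2 < 1 - w).
  { assert ((1 - w) ^ 3 < 1) by (apply pow_lt_1_compat; [lra | auto with arith]).
    replace (((1 - w) ^ 2) ^ 2) with ((1 - w) ^ 3 * (1 - w)) by ring. nra. }
  apply sqrt_lt_1; try apply sqrt_pos; apply sqrt_lt_1; try lra.
  apply pow2_ge_0.
- replace (2 / PI * ln (2 * y)) with (1 / PI * ln (2 * y * (2 * y)))
    by (rewrite ln_mult by lra; field; lra).
  apply Rmult_lt_compat_l; [lra |].
  assert (sqrt (1 - / y ^ 4) < 1) by (apply sqrt_lt_of_sq; lra).
  pose proof (sqrt_pos (1 - / y ^ 4)).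
  apply ln_increasing; [apply Rmult_lt_0_compat; nra |].
  replace (2 * y * (2 * y)) with (2 * y ^ 2 * 2) by ring.
  apply Rmult_lt_compat_l; nra.
Qed.
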